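(* Let $\mathbb{X}\subseteq\mathbb{R}^n$ be the countable set of possible datasets, let $f:\mathbb{X}\to\mathbb{R}^q$ be a query and $\mathfrak{M}:\mathbb{R}^q\to\mathbb{R}^q$ a mapping such that $\mathfrak{M}\circ f$ is $\epsilon$-noiselessly private, $\epsilon>0$. Fix $i\in\{1,\dots,n\}$ and any sequence of mappings $\psi^{\ell}_{i,v_{-i}}\in\Psi_i$, $\ell\in\mathbb{N}$ (the constants $v_{-i}$ may depend on $\ell$). Consider the memory-less $\epsilon$-noiselessly-private channel which maps an uncertain time series $(X[\ell])_{\ell\in\mathbb{N}}$ of discrete uncertain variables with values in $\mathbb{X}$ to $(Y[\ell])_{\ell\in\mathbb{N}}$, where $Y[\ell]=\mathfrak{M}\circ f\circ\psi^{\ell}_{i,v_{-i}}\circ X[\ell]$ for all $\ell$. Then the zero-error capacity $C_0$ of this channel satisfies $$C_0\le\epsilon .$$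
   Context: An uncertain variable is a map on a nonempty set $\Omega$ (no measure assumed); its range is $[\![X]\!]=\{X(\omega):\omega\in\Omega\}$, and it is discrete if this range is countable. An uncertain time series is a sequence of uncertain variables. For a dataset $x=(x_1,\dots,x_n)\in\mathbb{X}$, $x_{-i}$ denotes the vector with the $i$-th entry removed. Let $\mathbb{X}_i$ and $\mathbb{X}_{-i}$ be the projections of $\mathbb{X}$ to the $i$-th coordinate and to the remaining coordinates. $\mathfrak{M}\circ f$ is $\epsilon$-noiselessly private if, for all $i$ and all $v_{-i}\in\mathbb{X}_{-i}$, the set $\{\mathfrak{M}(f(x)):x\in\mathbb{X},\ x_{-i}=v_{-i}\}$ has at most $2^\epsilon$ elements. For $v_{-i}\in\mathbb{X}_{-i}$, $\psi_{i,v_{-i}}$ is the map on $\mathbb{X}$ given by $\psi_{i,v_{-i}}(x)=(v_1,\dots,v_{i-1},x_i,v_{i+1},\dots,v_n)$, and $\Psi_i=\{\psi_{i,v_{-i}}:v_{-i}\in\mathbb{X}_{-i}\}$. It is understood that $\mathbb{X}$ contains every vector with $i$-th entry in $\mathbb{X}_i$ and remaining entries in $\mathbb{X}_{-i}$, so that $f\circ\psi_{i,v_{-i}}$ is defined. Zero-error capacity. For an output sequence $(y[k],\dots,y[1])$ let $\mathcal{X}(y[k],\dots,y[1])\subseteq\mathbb{X}^k$ be the set of input sequences compatible with it, i.e. those $(x[k],\dots,x[1])$ for which the channel can output $(y[k],\dots,y[1])$ (here: $\mathfrak{M}\circ f\circ\psi^\ell_{i,v_{-i}}(x[\ell])=y[\ell]$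 for all $1\le \ell\le k$). A code of length $k$ is a finite set $\mathcal{F}\subseteq\mathbb{X}^k$. Then $$C_0=\lim_{k\to\infty}\ \sup_{\mathcal{F}}\ \frac{\log_2|\mathcal{F}|}{k},$$ where the supremum is over codes $\mathcal{F}$ of length $k$ with $|\mathcal{F}\cap\mathcal{X}(y[k],\dots,y[1])|\le 1$ for all output sequences $(y[k],\dots,y[1])$. $C_0$ refers to this limit whenever it exists. *)

(* Defs.v *)
From HB Require Import structures.
From mathcomp Require Import all_boot all_order all_algebra finmap.
From mathcomp Require Import all_classical all_reals all_analysis.

Set Implicit Arguments.
Unset Strict Implicit.
Unset Printing Implicit Defensive.

Import Order.TTheory GRing.Theory Num.Theory.
Import numFieldNormedType.Exports.

Local Open Scope classical_set_scope.
Local Open Scope ring_scope.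

(* An uncertain variable is a bare map on a sample space, with no measure.
   Time is indexed from 0. *)
Definition uncertain_series (Omega S : Type) := nat -> Omega -> S.

Definition discrete_uncertain (Omega S : Type) (X : Omega -> S) : Prop :=
  countable (range X).

(* A channel acts on uncertain time series over every sample space. *)
Definition channel (S T : Type) :=
  forall Omega : Type, uncertain_series Omega S -> uncertain_series Omega T.

Definition memoryless_channel (S T : Type) (g : nat -> S -> T) : channel S T :=
  fun Omega X l => g l \o X l.

Section ZeroErrorCapacity.
Variables (R : realType) (S : choiceType) (T : Type).
Variables (A : set S) (ch : channel S T).

Definition compatible (k : nat) (y : {ffun 'I_k -> T}) :
    set {ffun 'I_k -> S} :=
  [set x | exists (Omega : Type) (X : uncertain_series Omega S) (w : Omega),
     [/\ forall l, discrete_uncertain (X l) /\ range (X l) `<=` A,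
         forall l : 'I_k, X l w = x l
       & forall l : 'I_k, ch X l w = y l]].

Definition zero_error_code (k : nat) (F : {fset {ffun 'I_k -> S}}) : Prop :=
  (forall x, x \in F -> forall l, A (x l)) /\
  forall y : {ffun 'I_k -> T},
    (#|` [fset x in F | x \in compatible y]%fset| <= 1)%N.

Definition log2 (x : R) : R := ln x / ln 2.

(* The empty code is admitted with [log2 0 = 0] instead of -oo; this does not
   change the supremum when [A] is nonempty, as singletons are zero-error
   codes of rate 0. *)
Definition zero_error_rate (k : nat) : \bar R :=
  ereal_sup [set (log2 #|` F|%:R / k%:R)%:E | F in @zero_error_code k].

(* Meaningful only when [cvgn zero_error_rate]. *)
Definition zero_error_capacity : \bar R := limn zero_error_rate.

End ZeroErrorCapacity.

(* For a memoryless channel, [compatible] is the expected pointwise set. *)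
Lemma compatible_memoryless (S : choiceType) (T : Type) (A : set S)
    (g : nat -> S -> T) (k : nat) (y : {ffun 'I_k -> T}) :
  A !=set0 ->
  compatible A (memoryless_channel g) y =
  [set x : {ffun 'I_k -> S} | forall l, A (x l) /\ g l (x l) = y l].
Proof.
case=> a Aa; apply/seteqP; split=> x /=.
  case=> Omega [X] [w] [hX hx hy] l; split.
    by rewrite -hx; apply: (hX l).2; exists w.
  by rewrite -hx -hy.
move=> h; pose X (l : nat) (_ : unit) := oapp (fun j => x j) a (insub l).
exists unit, X, tt; split.
- move=> l; split; first exact/finite_set_countable/finite_image/finite_finset.
  move=> _ [[] _ <-]; rewrite /X; case: insubP => //= j _ _.
  exact: (h j).1.
- by move=> l; rewrite /X valK.
- by move=> l; rewrite /memoryless_channel /= /X valK /=; exact: (h l).2.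
Qed.

Section NoiselessPrivacy.
Variables (R : realType) (n q : nat).
Implicit Types (D : set 'rV[R]_n) (i : 'I_n) (v : 'rV[R]_n.-1).

(* [col' i x] is x with its i-th entry removed. *)
Definition proj_at D i : set R := [set x 0 i | x in D].
Definition proj_others D i : set 'rV[R]_n.-1 := [set col' i x | x in D].

(* f is total; only its values on D matter. *)
Definition noiselessly_private D (f : 'rV[R]_n -> 'rV[R]_q)
    (M : 'rV[R]_q -> 'rV[R]_q) (eps : R) : Prop :=
  forall i v, proj_others D i v ->
    let out := [set M (f x) | x in [set x | D x /\ col' i x = v]] in
    finite_set out /\ #|` fset_set out|%:R <= 2 `^ eps.

Definition psi i v (x : 'rV[R]_n) : 'rV[R]_n :=
  \row_j if unlift i j is Some j' then v 0 j' else x 0 i.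

Definition Psi D i : set ('rV[R]_n -> 'rV[R]_n) :=
  [set psi i v | v in proj_others D i].

Lemma psi_at i v x : psi i v x 0 i = x 0 i.
Proof. by rewrite mxE unlift_none. Qed.

Lemma psi_others i v x : col' i (psi i v x) = v.
Proof. by apply/rowP => j; rewrite !mxE liftK. Qed.

End NoiselessPrivacy.

(* Main.v *)
(* Distinct codewords of a zero-error code have distinct outputs.  The [l]-th
output symbol [M (f (psi i v x))] takes at most [2 `^ eps] values by privacy, because
[psi i v x] lies in the dataset space and has its other entries equal to [v].
A code of length [k] thus has at most [2 `^ (eps * k)] words. *)

Require Import Defs.
From HB Require Import structures.
From mathcomp Require Import all_boot all_order all_algebra finmap.
From mathcomp Require Import all_classical all_reals all_analysis.
Set Implicit Arguments.
Unset Strict Implicit.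
Unset Printing Implicit Defensive.
Import Order.TTheory GRing.Theory Num.Theory.
Import numFieldNormedType.Exports.
Local Open Scope classical_set_scope.
Local Open Scope ring_scope.

(** Two codewords with equal outputs are both compatible with that output word, so a zero-error code
    cannot contain them as distinct elements. *)
Lemma zero_error_code_inj (S : choiceType) (T : Type) (A : set S)
    (g : nat -> S -> T) (k : nat) (F : {fset {ffun 'I_k -> S}}) :
  zero_error_code A (memoryless_channel g) F ->
  {in F &, forall x x' : {ffun 'I_k -> S},
    (forall l : 'I_k, g l (x l) = g l (x' l)) -> x = x'}.
Proof.
case=> FA F1 x x' xF x'F gxx'; apply/eqP; apply: contraT => nxx'.
(* Words of length 0 are all equal. Otherwise some letter of [x] shows that [A] is nonempty, as
   [compatible_memoryless] requires. *)
have [k0|/card_gt0P[l0 _]] := posnP #|'I_k|.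
  case/eqP: nxx'; apply/ffunP => l; by case: (fintype0 l k0).
have A0 : A !=set0 by exists (x l0); exact: FA.
have := F1 [ffun l => g (l : 'I_k) (x l)]; rewrite leqNgt => /negP; case.
rewrite compatible_memoryless//.
have /eqP : #|` [fset x; x']%fset| = 2 by rewrite cardfs2 nxx'.
rewrite eqn_leq => /andP[_ /leq_trans]; apply; apply: fsubset_leq_card.
apply/fsubsetP => z; rewrite !inE /=.
by case/orP => /eqP ->; rewrite ?xF ?x'F /=; apply/mem_set => l;
  rewrite ffunE; split=> //; exact: FA.
Qed.

(** Recording the position of each output symbol in the list [O l] injects the code into the words
    of length [k] over [N] letters. *)
Lemma card_zero_error_code (S : choiceType) (T : eqType) (A : set S)
    (g : nat -> S -> T) (O : nat -> seq T) (N k : nat)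
    (F : {fset {ffun 'I_k -> S}}) :
  (forall l x, A x -> g l x \in O l) -> (forall l, (size (O l) <= N)%N) ->
  zero_error_code A (memoryless_channel g) F -> (#|` F| <= N ^ k)%N.
Proof.
move=> gO ON F0; have FA := F0.1.
have [->//|] := posnP #|` F|; rewrite cardfs_gt0 => /fset0Pn[x0 x0F].
case: k F F0 FA x0 x0F => [|k] F F0 FA x0 x0F.
  rewrite expn0; suff -> : F = [fset x0]%fset by rewrite cardfs1.
  apply/fsetP => x; rewrite !inE; apply/idP/eqP => [_|-> //].
  by apply/ffunP => -[].
(* [inord] needs a nonempty ordinal type; [N = 0] is impossible, since [O 0] contains an output of
   [x0]. *)
case: N ON => [|N] ON.
  have /eqP/size0nil O0 : size (O 0%N) == 0 by rewrite -leqn0.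
  by have := gO 0%N _ (FA _ x0F ord0); rewrite O0.
pose h (x : {ffun 'I_k.+1 -> S}) : {ffun 'I_k.+1 -> 'I_N.+1} :=
  [ffun l => inord (index (g (l : 'I_k.+1) (x l)) (O l))].
have h_inj : {in F &, injective h}.
  move=> x x' xF x'F hxx'; apply: (zero_error_code_inj F0) => // l.
  have gx z : z \in F -> g l (z l) \in O l by move=> zF; apply/gO/FA.
  (* Below [N.+1], [inord] loses no information, so equal codes give equal positions and hence equal
     symbols. *)
  have idx z : z \in F -> (index (g l (z l)) (O l) < N.+1)%N.
    by move=> zF; apply: leq_trans (ON l); rewrite index_mem gx.
  have /(congr1 val) := congr1 (fun u : {ffun _ -> _} => u l) hxx'.
  rewrite !ffunE /= !inordK ?idx// => ii'.
  by rewrite -(nth_index (g l (x l)) (gx _ xF)) ii' nth_index ?gx.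
have /card_uniqP sz : uniq (map h F) by rewrite map_inj_in_uniq ?fset_uniq.
by rewrite -(size_map h) -sz (leq_trans (max_card _))// card_ffun !card_ord.
Qed.

Lemma zero_error_rate_le (R : realType) (S : choiceType) (T : eqType)
    (A : set S) (g : nat -> S -> T) (O : nat -> seq T) (eps : R) (k : nat) :
  0 <= eps ->
  (forall l x, A x -> g l x \in O l) ->
  (forall l, (size (O l))%:R <= 2 `^ eps) ->
  (zero_error_rate R A (memoryless_channel g) k <= eps%:E)%E.
Proof.
move=> eps0 gO Oeps; apply: ge_ereal_sup => _ [F F0 <-]; rewrite lee_fin.
(* At length 0 the rate is a division by zero, with value 0. *)
have [k0|k0] := posnP k; first by rewrite [X in _ / X%:R]k0 invr0 mulr0.
have ln2_gt0 : 0 < ln 2 :> R by rewrite ln_gt0// ltr1n.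
rewrite ler_pdivrMr ?ltr0n// /log2 ler_pdivrMr//.
have [->|F_gt0] := posnP #|` F|; first by rewrite ln0// !mulr_ge0// ltW.
have -> : eps * k%:R * ln 2 = ln ((2 `^ eps) ^+ k).
  by rewrite lnXn ?powR_gt0// ln_powR -[RHS]mulr_natr mulrAC.
rewrite ler_ln ?posrE ?ltr0n ?exprn_gt0 ?powR_gt0//.
have ON l : (size (O l) <= Num.truncn (2 `^ eps))%N.
  by rewrite truncn_ge_nat ?powR_ge0.
apply: (@le_trans _ _ ((Num.truncn (2 `^ eps))%:R ^+ k)).
  by rewrite -natrX ler_nat; exact: (card_zero_error_code gO).
by rewrite lerXn2r ?nnegrE ?powR_ge0// truncn_le ?powR_ge0.
Qed.

Theorem theorem2 (R : realType) (n q : nat) (D : set 'rV[R]_n)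
    (f : 'rV[R]_n -> 'rV[R]_q) (M : 'rV[R]_q -> 'rV[R]_q) (eps : R) (i : 'I_n)
    (psis : nat -> 'rV[R]_n -> 'rV[R]_n)
    (D_countable : countable D)
    (D_prod : forall x : 'rV[R]_n,
       proj_at D i (x 0 i) -> proj_others D i (col' i x) -> D x)
    (eps_gt0 : 0 < eps)
    (private : noiselessly_private D f M eps)
    (psisP : forall l, Psi D i (psis l)) :
  let ch : channel 'rV[R]_n 'rV[R]_q :=
    memoryless_channel (fun l => M \o f \o psis l) in
  cvgn (zero_error_rate R D ch) ->
  (zero_error_capacity R D ch <= eps%:E)%E.
Proof.
move=> ch rate_cvg; apply: lime_le => //; apply: nearW => k.
pose O l := fset_set [set M (f (psis l x)) | x in D].
suff Oprop l : finite_set [set M (f (psis l x)) | x in D] /\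
    #|` O l|%:R <= 2 `^ eps :> R.
  apply: (@zero_error_rate_le _ _ _ _ _ (fun l => enum_fset (O l))).
  - exact: ltW.
  - move=> l x Dx; have := in_fset_set (Oprop l).1 => -> /=.
    by apply/mem_set; exists x.
  - by move=> l; exact: (Oprop l).2.
have [v vD psiE] := psisP l.
have [fin_out card_out] := private _ _ vD.
(* [psis l x] keeps the [i]-th entry of [x] and has [v] elsewhere, so [D_prod] puts it in [D], in
   the fibre over [v] that privacy controls. *)
have sub : [set M (f (psis l x)) | x in D] `<=`
    [set M (f x) | x in [set x | D x /\ col' i x = v]].
  move=> _ [x Dx <-]; exists (psis l x) => //; rewrite -psiE /=.
  rewrite psi_others; split=> //; apply: D_prod; last by rewrite psi_others.
  by rewrite psi_at; exists x.
have fin : finite_set [set M (f (psis l x)) | x in D]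
  by exact: sub_finite_set fin_out.
split=> //; apply: le_trans card_out; rewrite ler_nat.
by apply: fsubset_leq_card; rewrite -fset_set_sub.
Qed.
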